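(* Let $G$ be a regular bi-directed graph of degree $d$ with $P$ vertices. Then every one-way communication graph for universal broadcast on $G$ has time $\tau\ge \frac{2(P-1)}{d}$.
   Context: A bi-directed graph is one in which whenever $(u,v)$ is a directed edge so is $(v,u)$; regular of degree $d$ means each vertex has exactly $d$ neighbours. A task graph on $G$ is a finite sequence $(e_i)$ of directed edges of $G$ labeled by positive integer times $t(e_i)$ such that (i) $t(e_i)<t(e_j)$ implies $e_i<e_j$ or $e_i,e_j$ incomparable, and (ii) $t(e_i)=t(e_j)$ implies $i=j$ or $e_i,e_j$ incomparable, where $e_i<e_j$ means there is a directed path in the task graph beginning with $e_i$ and ending with $e_j$. Its time is its maximum label. A one-way communication graph is a collection of task graphs such that no two edge occurrences in the collection that join the same two vertices (in either direction) carry the same label; its time is the maximum time of its task graphs. A broadcast from $v$ is a task graph containing a directed path from $v$ to every other vertex; a one-way communication graph for universal broadcast consists of a broadcast from each vertex. *)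

(* Defs.v *)
From mathcomp Require Import all_boot all_order all_algebra.

Set Implicit Arguments.
Unset Strict Implicit.
Unset Printing Implicit Defensive.

(* A directed graph on the finite vertex set [V] is a relation [G : rel V];
   loops are not excluded, and a vertex carrying a loop is one of its own
   neighbours. *)
Definition bidirected (V : finType) (G : rel V) : Prop :=
  forall u v : V, G u v -> G v u.

Definition regular (V : finType) (G : rel V) (d : nat) : Prop :=
  forall v : V, #|[set w | G v w]| = d.

Section Precedence.
Variables (V : finType) (n : nat) (edge : 'I_n -> V * V).

Definition consecutive : rel 'I_n := fun i j => (edge i).2 == (edge j).1.

(* Some directed path, made of edges of the sequence, begins with the i-th edge
   and ends with the j-th one.  Paths may revisit vertices, and the one-edge
   path makes the relation reflexive. *)
Definition precedes (i j : 'I_n) : bool := connect consecutive i j.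

Definition incomparable (i j : 'I_n) : bool :=
  ~~ precedes i j && ~~ precedes j i.

End Precedence.

(* The same edge of [G] may occur at several positions of the sequence, so times
   and precedence are attached to positions. *)
Record task_graph (V : finType) (G : rel V) := TaskGraph {
  tg_size : nat;
  tg_edge : 'I_tg_size -> V * V;
  tg_time : 'I_tg_size -> nat;
  tg_edge_in : forall i, G (tg_edge i).1 (tg_edge i).2;
  tg_time_gt0 : forall i, 0 < tg_time i;
  tg_time_lt : forall i j, tg_time i < tg_time j ->
    precedes tg_edge i j \/ incomparable tg_edge i j;
  tg_time_eq : forall i j, tg_time i = tg_time j ->
    i = j \/ incomparable tg_edge i j
}.
Arguments tg_edge {V G} T i : rename.
Arguments tg_time {V G} T i : rename.

Section TaskGraph.
Variables (V : finType) (G : rel V).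

Definition tg_rel (T : task_graph G) : rel V :=
  fun u v => [exists i, tg_edge T i == (u, v)].

Definition tg_max_time (T : task_graph G) : nat :=
  \max_(i < tg_size T) tg_time T i.

Definition broadcast (v : V) (T : task_graph G) : Prop :=
  forall w : V, w != v -> connect (tg_rel T) v w.

Definition same_ends (a b : V * V) : bool := (a == b) || (a == (b.2, b.1)).

(* A collection of task graphs is a finite family.  An edge occurrence in it is
   a pair of a member [k] and a position in the sequence of that member. *)
Definition occurrence (I : finType) (C : I -> task_graph G) : Type :=
  {k : I & 'I_(tg_size (C k))}.

Definition occ_edge (I : finType) (C : I -> task_graph G)
    (x : occurrence C) : V * V := tg_edge (C (tag x)) (tagged x).

Definition occ_time (I : finType) (C : I -> task_graph G)
    (x : occurrence C) : nat := tg_time (C (tag x)) (tagged x).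

Definition one_way_communication_graph (I : finType)
    (C : I -> task_graph G) : Prop :=
  forall x y : occurrence C, x <> y ->
    same_ends (occ_edge x) (occ_edge y) -> occ_time x <> occ_time y.

Definition communication_time (I : finType) (C : I -> task_graph G) : nat :=
  \max_(k : I) tg_max_time (C k).

(* One task graph per vertex, so the family is indexed by [V] itself. *)
Definition universal_broadcast (C : V -> task_graph G) : Prop :=
  one_way_communication_graph C /\ forall v : V, broadcast v (C v).

End TaskGraph.

(* Main.v *)
(* Count pairs (occurrence of a non-loop edge, orientation).  Every broadcast
   from v enters each of the P - 1 other vertices through a non-loop edge, so
   there are at least 2 P (P - 1) such pairs.  By the one-way condition a pair is
   determined by its oriented edge, which is one of P d, and its time, which is
   one of tau.  Hence 2 P (P - 1) <= P d tau. *)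
Require Import Defs.
From mathcomp Require Import all_boot all_order all_algebra.
Import Order.TTheory GRing.Theory Num.Theory.
Local Open Scope ring_scope.

Lemma connect_last_step (T : finType) (e : rel T) (x y : T) :
  connect e x y -> y != x -> exists2 z, z != y & e z y.
Proof.
move=> /connectP[p]; elim/last_ind: p y => [|p z IHp] y /=.
  by move=> _ ->; rewrite eqxx.
rewrite rcons_path last_rcons => /andP[xp pz] -> zx.
(* A final step that is a loop at [z] is dropped: the shorter path still ends at [z]. *)
have [pE|pNz] := eqVneq (last x p) z; last by exists (last x p).
exact: IHp.
Qed.

Lemma regular_card_arcs (V : finType) (G : rel V) (d : nat) :
  regular G d -> #|[set e : V * V | G e.1 e.2]| = (#|V| * d)%N.
Proof.
move=> regG; rewrite -sum_nat_const -sum1dep_card.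
rewrite -(pair_big_dep xpredT G (fun _ _ => 1%N)) /=.
by apply: eq_bigr => v _; rewrite sum1dep_card regG.
Qed.

(** These pairs are the arcs of the complete loopless graph, regular of degree [#|V|.-1]. *)
Lemma card_off_diagonal (V : finType) :
  #|[set p : V * V | p.2 != p.1]| = (#|V| * #|V|.-1)%N.
Proof.
apply: (@regular_card_arcs V (fun v w => w != v)) => v.
by rewrite -(cardsC1 v); apply: eq_card => w; rewrite !inE.
Qed.

Definition flip_if {T : Type} (b : bool) (e : T * T) : T * T :=
  if b then (e.2, e.1) else e.

Section Counting.
Variables (V : finType) (G : rel V) (C : V -> task_graph G).

Let occ : finType := {k : V & 'I_(tg_size (C k))}.
Let edge (x : occ) : V * V := @occ_edge V G V C x.
Let time (x : occ) : nat := @occ_time V G V C x.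

Definition nonloop_occurrences : {set occ} := [set x | (edge x).1 != (edge x).2].

(** Sending an occurrence to its broadcast's source and its edge's head covers all off-diagonal
    pairs, already on non-loop occurrences. *)
Lemma broadcast_card_nonloop :
  (forall v, broadcast v (C v)) ->
  (#|V| * #|V|.-1 <= #|nonloop_occurrences|)%N.
Proof.
move=> bC; rewrite -card_off_diagonal.
apply: leq_trans (leq_imset_card (fun x : occ => (tag x, (edge x).2)) _).
apply/subset_leq_card/subsetP => -[v w]; rewrite inE /= => wv.
have [u uw /existsP[i /eqP iE]] := connect_last_step _ _ _ _ (bC v w wv) wv.
apply/imsetP; exists (Tagged (fun k => 'I_(tg_size (C k))) i : occ).
  by rewrite inE /edge /occ_edge /= iE.
by rewrite /edge /occ_edge /= iE.
Qed.

Lemma occ_time_bounds (x : occ) : (0 < time x <= communication_time C)%N.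
Proof.
case: x => k i; rewrite /time /occ_time /= tg_time_gt0 /=.
apply: leq_trans (leq_bigmax (F := fun k => tg_max_time (C k)) k).
exact: (leq_bigmax (F := fun i => tg_time (C k) i) i).
Qed.

Lemma card_nonloop_le (d : nat) :
  bidirected G -> regular G d -> one_way_communication_graph C ->
  (2 * #|nonloop_occurrences| <= #|V| * d * communication_time C)%N.
Proof.
move=> biG regG oneway; set tau := communication_time C.
pose slot (p : bool * occ) : (V * V) * 'I_tau.+1 :=
  (flip_if p.1 (edge p.2), inord (time p.2)).
pose A : {set bool * occ} := setX setT nonloop_occurrences.
have -> : (2 * #|nonloop_occurrences| = #|A|)%N.
  by rewrite cardsX cardsT card_bool.
have timeK (x : occ) : (inord (time x) : 'I_tau.+1) = time x :> nat.
  by rewrite inordK // ltnS; case/andP: (occ_time_bounds x).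
have slot_inj : {in A &, injective slot}.
  move=> [b x] [c y]; rewrite !inE /= => xN _ [fE /(congr1 val)] /=.
  rewrite !timeK => tE.
  have xy : x = y.
    apply/eqP/negPn/negP => /eqP /oneway /(_ _ tE); apply.
    move: fE; rewrite -/(edge x) -/(edge y) /same_ends.
    case: (edge x) (edge y) => [a1 a2] [b1 b2].
    by case: b c => -[] [-> ->] /=; rewrite eqxx ?orbT.
  rewrite -{y tE}xy in fE *; congr (_, _).
  (* A non-loop edge differs from its reversal, so the orientation bit can be read off. *)
  move: xN fE; case: (edge x) => [a1 a2] /= aN.
  by case: b c => -[] // [E _]; move: aN; rewrite E eqxx.
rewrite -(card_in_imset slot_inj) -(regular_card_arcs _ _ _ regG).
(* Labels are positive, so the value 0 of ['I_tau.+1] is never taken; this gives the factor [tau]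
   rather than [tau.+1]. *)
have tauE : #|[set~ (ord0 : 'I_tau.+1)]| = tau by rewrite cardsC1 card_ord.
rewrite -[X in (_ <= _ * X)%N]tauE -cardsX; apply/subset_leq_card/subsetP => _ /imsetP[[b x] _ ->].
rewrite !inE /= -val_eqE /= timeK -lt0n.
have /andP[-> _] := occ_time_bounds x; rewrite andbT.
have Gx : G (edge x).1 (edge x).2 by apply: tg_edge_in.
by case: b => //=; apply: biG.
Qed.

End Counting.

Theorem theorem3p2 (V : finType) (G : rel V) (d : nat)
    (G_bidirected : bidirected G) (G_regular : regular G d)
    (C : V -> task_graph G) (C_universal : universal_broadcast C) :
  2 * (#|V|%:R - 1) / d%:R <= (communication_time C)%:R :> rat.
Proof.
case: C_universal => oneway bC.
have le1 := card_nonloop_le _ _ _ _ G_bidirected G_regular oneway.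
have le2 := broadcast_card_nonloop _ _ _ bC.
(* For [d = 0] the quotient is 0, since [0^-1 = 0] in [rat]. *)
have [->|d_gt0] := posnP d; first by rewrite invr0 mulr0 ler0n.
rewrite ler_pdivrMr ?ltr0n // -natrM.
(* On the empty graph [#|V|%:R - 1] is -1, unlike the truncated [#|V|.-1], so the left side is
   negative. *)
have [->|V_gt0] := posnP #|V|.
  by apply: le_trans (ler0n _ _); rewrite sub0r mulrN1 oppr_le0 ler0n.
rewrite -subn1 in le2.
rewrite -[X in _ - X]/(1%:R) -natrB // -natrM ler_nat -(leq_pmul2l V_gt0) mulnCA.
rewrite [(_ * d)%N]mulnC [leqRHS]mulnA; apply: leq_trans le1.
by rewrite leq_pmul2l.
Qed.
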